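(* If $S$ is a generalised nice set, then the map $\varepsilon^S\colon G\times G\to\mathbb{F}$, $G=\mathbb{Z}_2^3$, defined by $$\varepsilon^S(g_i,g_j)=\begin{cases}1&\text{if }\{i,j\}\in S,\\0&\text{if }\{i,j\}\notin S,\end{cases}$$ is a generic graded contraction with support $S$.
   Context: $\mathbb{F}$ is an algebraically closed field of characteristic zero. The elements of $G=\mathbb{Z}_2^3$ are labelled $g_0=(0,0,0)$, $g_1=(1,0,0)$, $g_2=(0,1,0)$, $g_3=(0,0,1)$, $g_4=(1,1,1)$, $g_5=(1,1,0)$, $g_6=(1,0,1)$, $g_7=(0,1,1)$; $I_0=\{0,\dots,7\}$ and $i*j\in I_0$ is defined by $g_i+g_j=g_{i*j}$. $X_0$ is the set of all unordered pairs $\{i,j\}$ with $i,j\in I_0$ (possibly $i=j$). For $i,j,k\in I_0$ (possibly repeated), $P_{\{i,j,k\}}=\{\{i,j\},\{j,k\},\{k,i\},\{i,j*k\},\{j,k*i\},\{k,i*j\}\}$. A subset $T\subseteq X_0$ is a generalised nice set if for all $i,j,k\in I_0$, $\{i,j\},\{i*j,k\}\in T$ implies $P_{\{i,j,k\}}\subseteq T$. A map $\varepsilon\colon G\times G\to\mathbb{F}$ is a generic graded contraction if, for all $g,h,k\in G$, $\varepsilon(g,h)=\varepsilon(h,g)$ and $\varepsilon(g,h,k)=\varepsilon(k,g,h)$, where $\varepsilon(g,h,k):=\varepsilon(g,h+k)\varepsilon(h,k)$. Its support is the set of unordered pairs $\{g,h\}$ with $\varepsilon(g,h)\neq0$, where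 $\{g_i,g_j\}$ is identified with $\{i,j\}\in X_0$. *)

(* Defs.v *)
From mathcomp Require Import all_boot all_algebra.

Set Implicit Arguments.
Unset Strict Implicit.
Unset Printing Implicit Defensive.

Import GRing.Theory.
Local Open Scope ring_scope.

Notation Z2cube := ('Z_2 * 'Z_2 * 'Z_2)%type.
Notation I0 := 'I_8.

Definition labels : 8.-tuple Z2cube :=
  [tuple (0, 0, 0); (1, 0, 0); (0, 1, 0); (0, 0, 1);
         (1, 1, 1); (1, 1, 0); (1, 0, 1); (0, 1, 1)].

Definition g (i : I0) : Z2cube := tnth labels i.

(* The label of a, i.e. the unique i such that g i = a: see gK and labK. *)
Definition lab (a : Z2cube) : I0 := inord (index a labels).

Lemma gK : cancel g lab.
Proof.
have lu : uniq labels by [].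
by move=> i; rewrite /lab /g (tnth_nth 0) index_uniq ?size_tuple ?inord_val.
Qed.

Lemma labK : cancel lab g.
Proof.
have lT (a : Z2cube) : a \in tval labels.
  by case: a => [[[[|[|[]]] // ?] [[|[|[]]] // ?]] [[|[|[]]] // ?]].
move=> a; have := lT a; rewrite -index_mem /= => la.
by rewrite /lab /g (tnth_nth 0) inordK // nth_index.
Qed.

Definition star (i j : I0) : I0 := lab (g i + g j).

Lemma g_star (i j : I0) : g i + g j = g (star i j).
Proof. by rewrite labK. Qed.

(* The unordered pair {i, j} is encoded as the set [set i; j], which is a
   singleton when i = j. *)
Definition X0 : {set {set I0}} := [set [set i; j] | i : I0, j : I0].

Definition Pset (i j k : I0) : {set {set I0}} :=
  [set [set i; j]; [set j; k]; [set k; i];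
       [set i; star j k]; [set j; star k i]; [set k; star i j]].

Definition generalised_nice (T : {set {set I0}}) : Prop :=
  T \subset X0 /\
  forall i j k : I0,
    [set i; j] \in T -> [set star i j; k] \in T -> Pset i j k \subset T.

Definition eps3 (F : fieldType) (eps : Z2cube -> Z2cube -> F)
    (a b c : Z2cube) : F :=
  eps a (b + c) * eps b c.

Definition generic_graded_contraction (F : fieldType)
    (eps : Z2cube -> Z2cube -> F) : Prop :=
  forall a b c : Z2cube,
    eps a b = eps b a /\ eps3 eps a b c = eps3 eps c a b.

(* The pair {g i, g j} of group elements is identified with {i, j}. *)
Definition contraction_support (F : fieldType) (eps : Z2cube -> Z2cube -> F) :
    {set {set I0}} :=
  [set [set i; j] | i in I0, j in I0 & eps (g i) (g j) != 0].

Definition epsS (F : fieldType) (S : {set {set I0}}) (a b : Z2cube) : F :=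
  if [set lab a; lab b] \in S then 1 else 0.

Lemma epsS_g (F : fieldType) (S : {set {set I0}}) (i j : I0) :
  epsS F S (g i) (g j) = if [set i; j] \in S then 1 else 0.
Proof. by rewrite /epsS !gK. Qed.

(* Main.v *)
Require Import Defs.
From mathcomp Require Import all_boot all_algebra.

Import GRing.Theory.

(** Since [epsS] takes only the values 0 and 1, [eps3] at [g i], [g j], [g k] is the indicator of
    [{i, j*k}] and [{j, k}] both lying in [S] ([eps3_epsS]). Niceness then puts all of [Pset j k i]
    in [S], a family invariant under cycling the indices, so the condition is cyclically invariant
    ([nice_rotE]). Symmetry is that of unordered pairs. *)

Lemma star_lab (a b : Z2cube) : star (lab a) (lab b) = lab (a + b)%R.
Proof. by rewrite /star !labK. Qed.

Lemma nice_rot (S : {set {set I0}}) (i j k : I0) : generalised_nice S ->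
  ([set i; star j k] \in S) && ([set j; k] \in S) ->
  ([set k; star i j] \in S) && ([set i; j] \in S).
Proof.
move=> [_ niceS] /andP[Si_jk Sjk].
(* Reads the pair as [{j*k, i}], the form niceness expects at the triple [j, k, i]. *)
rewrite setUC in Si_jk.
have /subsetP sub := niceS j k i Sjk Si_jk.
by rewrite !sub // !inE eqxx ?orbT.
Qed.

Lemma nice_rotE (S : {set {set I0}}) (i j k : I0) : generalised_nice S ->
  ([set i; star j k] \in S) && ([set j; k] \in S) =
  ([set k; star i j] \in S) && ([set i; j] \in S).
Proof.
move=> niceS; apply/idP/idP; first exact: nice_rot.
(* The rotation has order three, so its inverse is two further rotations. *)
by move=> /(nice_rot _ _ _ _ niceS) /(nice_rot _ _ _ _ niceS).
Qed.

Lemma eps3_epsS (F : fieldType) (S : {set {set I0}}) (a b c : Z2cube) :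
  eps3 (epsS F S) a b c =
  (if ([set lab a; star (lab b) (lab c)] \in S) && ([set lab b; lab c] \in S)
   then 1 else 0)%R.
Proof.
rewrite /eps3 /epsS star_lab.
by case: (_ \in S); case: (_ \in S); rewrite ?mulr1 ?mulr0.
Qed.

(** [S \subset X0] makes every member of [S] a pair [{i, j}], on which [epsS] is 1, hence
    nonzero. *)
Lemma contraction_support_epsS (F : fieldType) (S : {set {set I0}}) :
  S \subset X0 -> contraction_support (epsS F S) = S.
Proof.
move=> /subsetP SX0; apply/setP=> p; apply/imset2P/idP.
  case=> i j _; rewrite inE epsS_g => /andP[_].
  by case: ifP => [Sij _ -> | _ /eqP].
move=> Sp; have /imset2P[i j _ _ defp] := SX0 p Sp.
by exists i j; rewrite // inE epsS_g -defp Sp oner_neq0.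
Qed.

Theorem proposition3p5 (F : closedFieldType)
    (charF0 : [pchar F]%R =i pred0)
    (S : {set {set I0}}) (niceS : generalised_nice S) :
  generic_graded_contraction (epsS F S) /\ contraction_support (epsS F S) = S.
Proof.
split; last by apply: contraction_support_epsS; case: niceS.
move=> a b c; split; first by rewrite /epsS setUC.
by rewrite !eps3_epsS nice_rotE.
Qed.
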